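(* There exists a Banach space $X$ for which the class of narrow operators on $X$ is not closed under the operation $\mathbin{\tilde{+}}$, i.e., there are narrow operators $T_1: X\to Y_1$ and $T_2: X\to Y_2$ such that $T_1\mathbin{\tilde{+}}T_2$ is not narrow. In fact, $X=C([0,1],\ell_1)$ is such a space.
   Context: Banach spaces are real and ''operator'' means bounded linear operator between Banach spaces. $B(X)$ is the closed unit ball and $S(X)$ the unit sphere of a Banach space $X$. $C([0,1],\ell_1)$ is the space of continuous functions $[0,1]\to\ell_1$ with the sup-norm. An operator $T: X\to Z$ is narrow if for every $x,y\in S(X)$, every $x^*\in X^*$ and every $\varepsilon>0$ there is $u\in B(X)$ with $\|x+u\|>2-\varepsilon$ and $\|T(y-u)\|+|x^*(y-u)|<\varepsilon$. For operators $T_1: X\to Y_1$, $T_2: X\to Y_2$, the tilde-sum is the operator $T_1\mathbin{\tilde{+}}T_2: X\to Y_1\oplus_1 Y_2$, $x\mapsto (T_1x,T_2x)$, where $Y_1\oplus_1 Y_2$ carries the norm $\|(y_1,y_2)\|=\|y_1\|+\|y_2\|$. *)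

(* Defs.v *)
From HB Require Import structures.
From mathcomp Require Import all_boot all_order all_algebra.
From mathcomp Require Import all_classical all_reals.
From mathcomp Require Import topology normedtype sequences.

Set Implicit Arguments.
Unset Strict Implicit.
Unset Printing Implicit Defensive.

Import Order.TTheory GRing.Theory Num.Theory.
Import numFieldNormedType.Exports.

Local Open Scope classical_set_scope.
Local Open Scope ring_scope.

Section Ell1.
Context {R : realType}.
Implicit Types u v : nat -> R.

Definition summable_seq u : Prop := cvgn [series `|u k|]_k.

Definition ell1_pred : {pred nat -> R} := mem [set u | summable_seq u].

Lemma normed_series_homo u :
  {homo [series `|u k|]_k : m n / (m <= n)%N >-> m <= n}.
Proof. by apply: (@nondecreasing_series _ _ xpredT 0%N) => n _ _ /=. Qed.

Lemma summable_bound u (M : R) :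
  (forall n, [series `|u k|]_k n <= M) -> summable_seq u.
Proof.
move=> uM; apply: nondecreasing_is_cvgn; first exact: normed_series_homo.
by exists M => _ [n _ <-].
Qed.

Lemma normed_series_lim u n :
  summable_seq u -> [series `|u k|]_k n <= limn [series `|u k|]_k.
Proof.
by move=> cu; apply: nondecreasing_cvgn_le => //; exact: normed_series_homo.
Qed.

Lemma normed_seriesD u v n :
  [series `|(u + v) k|]_k n <= [series `|u k|]_k n + [series `|v k|]_k n.
Proof.
by rewrite /series /= -big_split /=; apply: ler_sum => i _; exact: ler_normD.
Qed.

Lemma normed_seriesZ (a : R) u :
  [series `|(a *: u) k|]_k = (fun n => `|a| * [series `|u k|]_k n).
Proof.
apply/funext => n; rewrite /series /= mulr_sumr.
by apply: eq_bigr => i _; rewrite -normrM.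
Qed.

Lemma ell1_submod_closed : submod_closed ell1_pred.
Proof.
split.
  rewrite inE; apply: (@summable_bound _ 0) => n.
  by rewrite /series /= big1 => [|i _]; rewrite ?normr0.
move=> a u v; rewrite !inE => cu cv.
apply: (@summable_bound _ (`|a| * limn [series `|u k|]_k +
                           limn [series `|v k|]_k)) => n.
apply: (le_trans (normed_seriesD _ _ _)).
apply: lerD; last exact: normed_series_lim.
by rewrite normed_seriesZ ler_wpM2l//; exact: normed_series_lim.
Qed.

HB.instance Definition _ :=
  GRing.isSubmodClosed.Build _ _ ell1_pred ell1_submod_closed.

End Ell1.

Record ell1 (R : realType) := Ell1 {
  ell1_val :> nat -> R ;
  ell1_valP : ell1_val \in ell1_pred }.

Section Ell1Norm.
Context {R : realType}.

HB.instance Definition _ := [isSub for @ell1_val R].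
HB.instance Definition _ := [Choice of ell1 R by <:].
HB.instance Definition _ := [SubChoice_isSubLmodule of ell1 R by <:].

Implicit Types u v : ell1 R.

Lemma ell1_summable u : summable_seq u.
Proof. by have := ell1_valP u; rewrite inE. Qed.

Definition ell1_norm u : R := limn [series `|u k|]_k.

Lemma ell1_norm_ub u n : [series `|u k|]_k n <= ell1_norm u.
Proof. exact/normed_series_lim/ell1_summable. Qed.

Lemma ell1_norm_le u (M : R) :
  (forall n, [series `|u k|]_k n <= M) -> ell1_norm u <= M.
Proof.
move=> uM; apply: limr_le; first exact: ell1_summable.
by near=> n; exact: uM.
Unshelve. all: by end_near. Qed.

Lemma ell1_coord_le u n : `|u n| <= ell1_norm u.
Proof.
apply: le_trans (ell1_norm_ub u n.+1); rewrite /series /= big_nat_recr//=.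
by rewrite lerDr sumr_ge0.
Qed.

Lemma ell1_ler_normD u v : ell1_norm (u + v) <= ell1_norm u + ell1_norm v.
Proof.
apply: ell1_norm_le => n; apply: (le_trans (normed_seriesD _ _ _)).
by apply: lerD; exact: ell1_norm_ub.
Qed.

Lemma ell1_normrZ (a : R) u : ell1_norm (a *: u) = `|a| * ell1_norm u.
Proof.
rewrite /ell1_norm (_ : _ (a *: u) = a *: (u : nat -> R))// normed_seriesZ.
by apply: limZr; exact: ell1_summable.
Qed.

Lemma ell1_normr0_eq0 u : ell1_norm u = 0 -> u = 0.
Proof.
move=> u0; apply/val_inj/funext => n /=; apply/normr0_eq0/le_anti.
by rewrite normr_ge0 andbT -u0 ell1_coord_le.
Qed.

HB.instance Definition _ := Lmodule_isNormed.Build R (ell1 R)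
  ell1_ler_normD ell1_normrZ ell1_normr0_eq0.

Lemma ell1_normE u : `|u| = limn [series `|u k|]_k.
Proof. by []. Qed.

Lemma ell1_complete (F : set_system (ell1 R)) :
  ProperFilter F -> cauchy F -> cvg F.
Proof.
move=> FF /cauchy_ballP Fc.
have Fn (e : R) : 0 < e -> \forall f & g \near F, `|f - g| < e.
  by move=> e0; have := Fc e e0; rewrite -ball_normE.
have coordc k : cvg ((fun f : ell1 R => f k) @ F).
  apply: cauchy_cvg; apply/cauchy_ballP => e e0; rewrite near_simpl.
  have /= := Fn e e0; rewrite near_map2; apply: filterS => -[f g] /= fg.
  by rewrite -ball_normE /=; exact: le_lt_trans (ell1_coord_le (f - g) k) fg.
pose u k := lim ((fun f : ell1 R => f k) @ F).
have key (e : R) : 0 < e ->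
    \forall f \near F, forall n, [series `|ell1_val f k - u k|]_k n <= e.
  move=> e0; have := Fn e e0 => /nearP_dep; apply: filterS => f fg n.
  have cs : (fun g : ell1 R => [series `|f k - g k|]_k n) @ F -->
      [series `|f k - u k|]_k n.
    apply: cvg_big => [|i _]; first exact: add_continuous.
    apply: cvg_norm; apply: cvgB; first exact: cvg_cst.
    exact: coordc.
  apply: (cvgr_to_le cs); near=> g.
  apply: (le_trans (ell1_norm_ub (f - g) n)); apply: ltW.
  by near: g; exact: fg.
have uP : (u : nat -> R) \in ell1_pred.
  have [f fu] := filter_ex (key 1 ltr01).
  have fuP : ((f : nat -> R) - u) \in ell1_pred.
    by rewrite inE; exact: (@summable_bound _ _ 1).
  have -> : u = (f : nat -> R) - ((f : nat -> R) - u).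
    by rewrite opprB addrC subrK.
  by rewrite rpredB// ell1_valP.
apply/cvg_ex; exists (Ell1 uP); apply/cvgrPdist_le => e e0.
have := key e e0; apply: filterS => f fu; rewrite distrC.
exact: ell1_norm_le.
Unshelve. all: by end_near. Qed.

HB.instance Definition _ := Uniform_isComplete.Build (ell1 R) ell1_complete.

End Ell1Norm.

Notation unit_itv R := (set_type `[0 : Real.sort R, 1]%classic).

Section Cont01.
Context {R : realType} {E : normedModType R}.

Definition cont01_pred : {pred unit_itv R -> E} :=
  mem [set f : unit_itv R -> E | continuous f].

Lemma cont01_submod_closed : submod_closed cont01_pred.
Proof.
split; first by rewrite inE => x; exact: cst_continuous.
move=> a f g; rewrite !inE => cf cg x.
apply: (@cvgD _ _ _ _ (nbhs_filter x)); last exact: cg.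
exact: (@cvgZl_tmp _ _ _ _ (nbhs_filter x)) (cf x).
Qed.

HB.instance Definition _ :=
  GRing.isSubmodClosed.Build _ _ cont01_pred cont01_submod_closed.

End Cont01.

Record cont01 (R : realType) (E : normedModType R) := Cont01 {
  cont01_val :> unit_itv R -> E ;
  cont01_valP : cont01_val \in cont01_pred }.

Section Cont01Norm.
Context {R : realType} {E : normedModType R}.

HB.instance Definition _ := [isSub for @cont01_val R E].
HB.instance Definition _ := [Choice of cont01 E by <:].
HB.instance Definition _ := [SubChoice_isSubLmodule of cont01 E by <:].

Implicit Types f g : cont01 E.

Lemma cont01_continuous f : continuous (f : unit_itv R -> E).
Proof. by have := cont01_valP f; rewrite inE. Qed.

(* The set under sup is nonempty and bounded, see cont01_has_sup. *)
Definition cont01_norm f : R := sup (range (fun t => `|f t|)).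

Lemma cont01_has_sup f : has_sup (range (fun t => `|f t|)).
Proof.
split.
  have x0 : (0 : R) \in `[0 : R, 1]%classic.
    by rewrite inE /= in_itv /= lexx ler01.
  by exists `|f (exist _ 0 x0)|; exists (exist _ 0 x0).
have : compact (valL_ 0 (f : unit_itv R -> E) @` `[0, 1]%classic).
  apply: continuous_compact; last exact: segment_compact.
  by apply/subspace_valL_continuousP'; exact: cont01_continuous.
move=> /compact_bounded [M [_ /(_ (M + 1))]]; rewrite ltrDl ltr01.
move=> /(_ isT) fM; exists (M + 1) => _ [t _ <-].
apply: fM; exists (set_val t); first exact: set_valP.
exact: (congr1 (@^~ t) (valLK 0 (f : unit_itv R -> E))).
Qed.

Lemma cont01_norm_ub f t : `|f t| <= cont01_norm f.
Proof. by apply: (sup_upper_bound (cont01_has_sup f)); exists t. Qed.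

Lemma cont01_norm_ge0 f : 0 <= cont01_norm f.
Proof.
have [[_ [t _ _]] _] := cont01_has_sup f.
exact: le_trans (normr_ge0 _) (cont01_norm_ub f t).
Qed.

Lemma cont01_norm_le f (M : R) : (forall t, `|f t| <= M) -> cont01_norm f <= M.
Proof.
move=> fM; apply: ge_sup; first by have [] := cont01_has_sup f.
by move=> _ [t _ <-].
Qed.

Lemma cont01_ler_normD f g :
  cont01_norm (f + g) <= cont01_norm f + cont01_norm g.
Proof.
apply: cont01_norm_le => t; apply: (le_trans (ler_normD (f t) (g t))).
by rewrite lerD// cont01_norm_ub.
Qed.

Lemma cont01_normrZ (a : R) f : cont01_norm (a *: f) = `|a| * cont01_norm f.
Proof.
have le b (h : cont01 E) : cont01_norm (b *: h) <= `|b| * cont01_norm h.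
  apply: cont01_norm_le => t; rewrite /= normrZ ler_wpM2l//.
  exact: cont01_norm_ub.
apply/le_anti; rewrite le /=; have [->|a0] := eqVneq a 0.
  by rewrite normr0 mul0r cont01_norm_ge0.
rewrite -ler_pdivlMl ?normr_gt0// -normfV.
by rewrite -[in leLHS](scalerK a0 f).
Qed.

Lemma cont01_normr0_eq0 f : cont01_norm f = 0 -> f = 0.
Proof.
move=> f0; apply/val_inj/funext => t /=; apply/normr0_eq0/le_anti.
by rewrite normr_ge0 andbT -f0 cont01_norm_ub.
Qed.

HB.instance Definition _ := Lmodule_isNormed.Build R (cont01 E)
  cont01_ler_normD cont01_normrZ cont01_normr0_eq0.

Lemma cont01_normE f : `|f| = sup (range (fun t => `|f t|)).
Proof. by []. Qed.

End Cont01Norm.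

Section Cont01Complete.
Context {R : realType} {E : completeNormedModType R}.

Lemma cont01_complete (F : set_system (cont01 E)) :
  ProperFilter F -> cauchy F -> cvg F.
Proof.
move=> FF /cauchy_ballP Fc.
have Fn (e : R) : 0 < e -> \forall f & g \near F, `|f - g| < e.
  by move=> e0; have := Fc e e0; rewrite -ball_normE.
have evc t : cvg ((fun f : cont01 E => f t) @ F).
  apply: cauchy_cvg; apply/cauchy_ballP => e e0; rewrite near_simpl.
  have /= := Fn e e0; rewrite near_map2; apply: filterS => -[f g] /= fg.
  by rewrite -ball_normE /=; exact: le_lt_trans (cont01_norm_ub (f - g) t) fg.
pose h t := lim ((fun f : cont01 E => f t) @ F).
have key (e : R) : 0 < e ->
    \forall f \near F, forall t, `|cont01_val f t - h t| <= e.
  move=> e0; have := Fn e e0 => /nearP_dep; apply: filterS => f fg t.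
  have ct : (fun g : cont01 E => `|f t - g t|) @ F --> `|f t - h t|.
    by apply: cvg_norm; apply: cvgB; [exact: cvg_cst|exact: evc].
  apply: (cvgr_to_le ct); near=> g.
  apply: (le_trans (cont01_norm_ub (f - g) t)); apply: ltW.
  by near: g; exact: fg.
have hP : (h : unit_itv R -> E) \in cont01_pred.
  rewrite inE => x; apply/(cvgrPdist_le (FF := nbhs_filter x)) => e e0.
  have e30 : 0 < e / 3 by rewrite divr_gt0.
  have [f fh] := filter_ex (key _ e30).
  have /(cvgrPdist_le (FF := nbhs_filter x))/(_ _ e30) :=
    @cont01_continuous _ _ f x.
  apply: (@filterS _ _ (nbhs_filter x)) => y fxy.
  have -> : h x - h y = (h x - f x) + (f x - f y) + (f y - h y).
    by rewrite !subrKA.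
  have -> : e = e / 3 + e / 3 + e / 3.
    by rewrite -!mulrDl -mulr2n -mulrSr -[e *+ 3]mulr_natr mulfK ?pnatr_eq0.
  apply: (le_trans (ler_normD _ _)); apply: lerD; last exact: fh.
  apply: (le_trans (ler_normD _ _)); apply: lerD; last exact: fxy.
  by rewrite distrC.
apply/cvg_ex; exists (Cont01 hP); apply/cvgrPdist_le => e e0.
have := key e e0; apply: filterS => f fh; rewrite distrC.
exact: cont01_norm_le.
Unshelve. all: by end_near. Qed.

HB.instance Definition _ :=
  Uniform_isComplete.Build (cont01 E) cont01_complete.

End Cont01Complete.

(* The product type of the library carries the max norm; the alias sum1 of the
   product carries the norm |y| + |z|. *)
Definition sum1 (R : realType) (Y Z : normedModType R) : Type := (Y * Z)%type.

Section Sum1.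
Context {R : realType} {Y Z : normedModType R}.

HB.instance Definition _ := GRing.Lmodule.copy (sum1 Y Z) (Y * Z)%type.

Implicit Types p q : sum1 Y Z.

Definition sum1_norm p : R := `|p.1| + `|p.2|.

Lemma sum1_ler_normD p q : sum1_norm (p + q) <= sum1_norm p + sum1_norm q.
Proof. by rewrite /sum1_norm addrACA lerD// ler_normD. Qed.

Lemma sum1_normrZ (a : R) p : sum1_norm (a *: p) = `|a| * sum1_norm p.
Proof. by rewrite /sum1_norm /= !normrZ mulrDr. Qed.

Lemma sum1_normr0_eq0 p : sum1_norm p = 0 -> p = 0.
Proof.
case: p => y z; rewrite /sum1_norm /= => /eqP.
by rewrite paddr_eq0// !normr_eq0 => /andP[/eqP -> /eqP ->].
Qed.

HB.instance Definition _ := Lmodule_isNormed.Build R (sum1 Y Z)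
  sum1_ler_normD sum1_normrZ sum1_normr0_eq0.

Lemma sum1_normE p : `|p| = `|p.1| + `|p.2|.
Proof. by []. Qed.

End Sum1.

Section Sum1Complete.
Context {R : realType} {Y Z : completeNormedModType R}.

Lemma sum1_complete (F : set_system (sum1 Y Z)) :
  ProperFilter F -> cauchy F -> cvg F.
Proof.
move=> FF /cauchy_ballP Fc.
have Fn (e : R) : 0 < e -> \forall f & g \near F, `|f - g| < e.
  by move=> e0; have := Fc e e0; rewrite -ball_normE.
have c1 : cvg ((fun f : sum1 Y Z => f.1) @ F).
  apply: cauchy_cvg; apply/cauchy_ballP => e e0; rewrite near_simpl.
  have /= := Fn e e0; rewrite near_map2; apply: filterS => -[f g] /= fg.
  by rewrite -ball_normE /=; apply: le_lt_trans fg; rewrite sum1_normE lerDl.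
have c2 : cvg ((fun f : sum1 Y Z => f.2) @ F).
  apply: cauchy_cvg; apply/cauchy_ballP => e e0; rewrite near_simpl.
  have /= := Fn e e0; rewrite near_map2; apply: filterS => -[f g] /= fg.
  by rewrite -ball_normE /=; apply: le_lt_trans fg; rewrite sum1_normE lerDr.
apply/cvg_ex; exists ((lim ((fun f : sum1 Y Z => f.1) @ F),
  lim ((fun f : sum1 Y Z => f.2) @ F)) : sum1 Y Z).
apply/cvgrPdist_le => e e0.
have e20 : 0 < e / 2 by rewrite divr_gt0.
near=> f; rewrite sum1_normE (splitr e) lerD//=.
  by near: f; apply: cvgr_dist_le; [exact: c1|].
by near: f; apply: cvgr_dist_le; [exact: c2|].
Unshelve. all: by end_near. Qed.

HB.instance Definition _ :=
  Uniform_isComplete.Build (sum1 Y Z) sum1_complete.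

End Sum1Complete.

Section TildeSum.
Context {R : realType} {X Y1 Y2 : normedModType R}.
Variables (T1 : {linear X -> Y1}) (T2 : {linear X -> Y2}).

Definition tilde_sum (x : X) : sum1 Y1 Y2 := (T1 x, T2 x).

Lemma tilde_sum_linear : linear tilde_sum.
Proof. by move=> a x y; rewrite /tilde_sum !linearP. Qed.

HB.instance Definition _ :=
  GRing.isLinear.Build R X (sum1 Y1 Y2) *:%R tilde_sum tilde_sum_linear.

Lemma tilde_sum_continuous :
  continuous T1 -> continuous T2 -> continuous tilde_sum.
Proof.
move=> c1 c2 x; apply/cvgrPdist_le => e e0.
have e20 : 0 < e / 2 by rewrite divr_gt0.
near=> y; rewrite sum1_normE (splitr e) lerD//=.
  by near: y; apply: cvgr_dist_le; [exact: c1|].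
by near: y; apply: cvgr_dist_le; [exact: c2|].
Unshelve. all: by end_near. Qed.

End TildeSum.

(* Boundedness of T is not part of this predicate: "bounded linear operator" is
   "linear and continuous" wherever the predicate is used. *)
Definition narrow (R : realType) (X Z : normedModType R)
    (T : {linear X -> Z}) : Prop :=
  forall x y : X, `|x| = 1 -> `|y| = 1 ->
  forall xs : {linear X -> R^o}, continuous xs ->
  forall e : R, 0 < e ->
  exists u : X, [/\ `|u| <= 1, 2 - e < `|x + u| &
    `|T (y - u)| + `|xs (y - u) : R| < e].

Definition narrow_not_tilde_closed (R : realType)
    (X : completeNormedModType R) : Prop :=
  exists (Y1 Y2 : completeNormedModType R)
         (T1 : {linear X -> Y1}) (T2 : {linear X -> Y2}),
    [/\ continuous T1, continuous T2, narrow T1, narrow T2 & ~ narrow (tilde_sum T1 T2)].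

(* Main.v *)
(* Let A and B be infinite sets of indices with A \cap B = {0}, and
   let s_A, s_B be the corresponding sums of coordinates on l_1. Each of them is
   blind to where its value comes from: s_A y can be realised by a unit vector
   supported arbitrarily far out, hence almost disjoint from any given x. Applied
   pointwise on a tiny interval, this makes f |-> s_A o f a narrow operator from
   C([0,1], l_1) to C[0,1]; the functional in the definition of narrowness is
   defeated by choosing one interval among many disjoint ones. Together, however,
   s_A and s_B detect e_0: a vector of the unit ball on which both are
   nearly -1 has its 0th coordinate near -1, so that it nearly cancels e_0. *)
Require Import Defs.
From HB Require Import structures.
From mathcomp Require Import all_boot all_order all_algebra.
From mathcomp Require Import all_classical all_reals.
From mathcomp Require Import topology normedtype sequences.
From mathcomp Require Import lra.

Set Implicit Arguments.
Unset Strict Implicit.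
Unset Printing Implicit Defensive.

Import Order.TTheory GRing.Theory Num.Theory.
Import numFieldNormedType.Exports.

Local Open Scope classical_set_scope.
Local Open Scope ring_scope.

(** * Unit vectors and sums of coordinates on l_1 *)

Section UnitVectors.
Context {R : realType}.
Implicit Types (x w : ell1 R) (A B : pred nat).

Lemma series_delta (c : R) N n :
  series (fun k => c * (k == N)%:R) n = if (N < n)%N then c else 0.
Proof.
rewrite /series /= -[RHS](big_nat1_eq +%R (fun=> c) N 0%N n) [RHS]big_mkcond.
by apply: eq_bigr => k _; case: eqP => _; rewrite ?mulr1 ?mulr0.
Qed.

Lemma ell1_unit_subproof N : (fun k => (k == N)%:R : R) \in ell1_pred.
Proof.
rewrite inE; apply: (@summable_bound _ _ 1) => n.
rewrite (_ : (fun k => _) = (fun k => 1 * (k == N)%:R)); last first.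
  by apply/funext => k; rewrite mul1r ger0_norm.
by rewrite series_delta; case: ifP.
Qed.

Definition ell1_unit N : ell1 R := Ell1 (ell1_unit_subproof N).

Lemma ell1_series_cvg x : [series `|x k|]_k @ \oo --> `|x|.
Proof. exact: ell1_summable. Qed.

Lemma ell1_coord_cvg0 x : (fun k => x k) @ \oo --> (0 : R).
Proof.
by apply/norm_cvg0P; apply: cvg_series_cvg_0; exact: ell1_summable.
Qed.

(** From index [N.+1] on, the partial sums for the two vectors differ by the constant contributed by
    the [N]-th term alone. *)
Lemma ell1_normD_unit x (c : R) N :
  `|x + c *: ell1_unit N| = `|x| - `|x N| + `|x N + c|.
Proof.
rewrite -addrA [- _ + _]addrC.
have cx : (fun n => [series `|x k|]_k n + (`|x N + c| - `|x N|)) @ \oo -->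
    `|x| + (`|x N + c| - `|x N|).
  by apply: cvgD; [exact: ell1_series_cvg|exact: cvg_cst].
apply: (cvg_unique _ (@ell1_series_cvg _)) => //.
apply: cvg_trans cx; apply: near_eq_cvg; near=> n.
have Nn : (N < n)%N by near: n; exists N.+1.
have := series_delta (`|x N + c| - `|x N|) N n; rewrite Nn => <-.
rewrite /series /= -big_split /=; apply: eq_bigr => k _.
rewrite -[(_ + _ *: _) k]/(x k + c * (k == N)%:R).
have [->|_] := eqVneq k N; first by rewrite !mulr1 addrC subrK.
by rewrite !mulr0 !addr0.
Unshelve. all: by end_near. Qed.

Lemma ell1_norm_unit N : `|ell1_unit N| = 1.
Proof.
have := ell1_normD_unit 0 1 N.
by rewrite scale1r -[(0 : ell1 R) N]/(0 : R) !add0r !normr0 normr1 subr0 add0r.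
Qed.

Lemma sum_on_summable A x : cvgn [normed series (fun k => (A k)%:R * x k)].
Proof.
apply: (@summable_bound _ _ `|x|) => n.
apply: le_trans (ell1_norm_ub x n); apply: ler_sum => k _.
by rewrite /= normrM ler_piMl// normr_nat lern1 leq_b1.
Qed.

Lemma sum_on_cvg A x : cvgn (series (fun k => (A k)%:R * x k)).
Proof. by apply: normed_cvg; exact: sum_on_summable. Qed.

Definition sum_on A x : R^o := limn (series (fun k => (A k)%:R * x k)).

Lemma sum_on_linear A : linear (sum_on A).
Proof.
move=> c x w; apply/cvg_lim => //.
rewrite (_ : series _ = c *: series (fun k => (A k)%:R * x k) +
                        series (fun k => (A k)%:R * w k)); last first.
  apply/funext => n; rewrite /series /= !fctE scaler_sumr -big_split /=.
  by apply: eq_bigr => k _; rewrite mulrDr mulrCA.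
apply: cvgD; last exact: sum_on_cvg.
by apply: cvgZr; exact: sum_on_cvg.
Qed.

HB.instance Definition _ A :=
  GRing.isLinear.Build R (ell1 R) R^o *:%R (sum_on A) (sum_on_linear A).

Lemma sum_on_unit A N : sum_on A (ell1_unit N) = (A N)%:R.
Proof.
apply/cvg_lim => //.
have cN : (fun=> (A N)%:R) @ \oo --> ((A N)%:R : R) by exact: cvg_cst.
apply: cvg_trans cN; apply: near_eq_cvg; near=> n.
have Nn : (N < n)%N by near: n; exists N.+1.
have := series_delta ((A N)%:R : R) N n; rewrite Nn => <-.
by apply: eq_bigr => k _; rewrite /=; case: eqP => [->//|_]; rewrite !mulr0.
Unshelve. all: by end_near. Qed.

Lemma sum_on_norm_le A x : `|sum_on A x| <= `|x|.
Proof.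
apply: le_trans (lim_series_norm (@sum_on_summable A x)) _.
apply: limr_le; first exact: sum_on_summable.
near=> n; apply: le_trans (ell1_norm_ub x n); apply: ler_sum => k _.
by rewrite /= normrM ler_piMl// normr_nat lern1 leq_b1.
Unshelve. all: by end_near. Qed.

Lemma sum_on_continuous A : continuous (sum_on A).
Proof.
apply/linear_bounded_continuous/linear_boundedP; near=> r => x.
apply: le_trans (sum_on_norm_le A x) _; by rewrite ler_peMl.
Unshelve. all: by end_near. Qed.

(** Termwise inclusion-exclusion. When [A] and [B] meet only in 0, it lets the two sums recover the
    0th coordinate. *)
Lemma sum_on_predUI A B x :
  sum_on A x + sum_on B x = sum_on (predU A B) x + sum_on (predI A B) x.
Proof.
rewrite /sum_on -!limD; try exact: sum_on_cvg.
congr (limn _); apply/funext => n; rewrite !fctE /series /=.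
rewrite -!big_split /=; apply: eq_bigr => k _; rewrite -!mulrDl -!natrD.
by case: (A k); case: (B k).
Qed.

Lemma sum_on_pred1 x N : sum_on (pred1 N) x = x N.
Proof.
apply/cvg_lim => //.
have cN : (fun=> x N) @ \oo --> (x N : R) by exact: cvg_cst.
apply: cvg_trans cN; apply: near_eq_cvg; near=> n.
have Nn : (N < n)%N by near: n; exists N.+1.
have := series_delta (x N) N n; rewrite Nn => <-.
apply: eq_bigr => k _; rewrite [RHS]mulrC /=; case: eqP => [->//|_].
by rewrite !mulr0.
Unshelve. all: by end_near. Qed.

End UnitVectors.

(* Strengthens the notion of a strong Daugavet operator, for which [T v] is only
   required to be close to [T y]. *)
Definition exact_strong_daugavet (R : realType) (E F : normedModType R)
    (T : E -> F) : Prop :=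
  forall x y : E, `|y| <= 1 -> forall e : R, 0 < e ->
  exists v : E, [/\ `|v| <= 1, T v = T y & `|x| + 1 - e <= `|x + v|].

Lemma sum_on_exact_strong_daugavet (R : realType) (A : pred nat) :
  (forall n, exists2 N, (n <= N)%N & A N) ->
  (forall n, exists2 N, (n <= N)%N & ~~ A N) ->
  exact_strong_daugavet (@sum_on R A).
Proof.
move=> Ainf Acinf x y y1 e e0.
(* Each of the two coordinates [N], [M] costs at most twice its absolute value in [x], so four times
   [e / 4] in total. *)
have e40 : 0 < e / 4 by rewrite divr_gt0.
have /cvgrPdist_le/(_ _ e40)[n _ xn] := @ell1_coord_cvg0 _ x.
have [N nN AN] := Ainf n; have [M nM AM] := Acinf n.
have {xn} [xN xM] : `|x N| <= e / 4 /\ `|x M| <= e / 4.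
  by move: (xn N nN) (xn M nM); rewrite !sub0r !normrN.
have NM : (M == N) = false by apply/eqP => MN; rewrite MN AN in AM.
set s := sum_on A y; have s1 : `|s| <= 1 := le_trans (sum_on_norm_le A y) y1.
have t0 : 0 <= 1 - `|s| by rewrite subr_ge0.
(* Index [N] in [A] carries the prescribed sum [s]; the remaining mass is put on [M] outside [A],
   where [sum_on A] does not see it, to bring the norm up to 1. *)
exists (s *: ell1_unit N + (1 - `|s|) *: ell1_unit M); split.
- apply: (le_trans (ler_normD _ _)).
  by rewrite !normrZ !ell1_norm_unit !mulr1 (ger0_norm t0) addrC subrK.
- by rewrite linearD !linearZ /= !sum_on_unit AN (negPf AM) scaler0 addr0
    [_ *: _]mulr1.
rewrite addrA ell1_normD_unit ell1_normD_unit.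
rewrite -[(x + s *: ell1_unit N) M]/(x M + s * (M == N)%:R) NM mulr0 addr0.
have := lerB_normD s (x N); have := lerB_normD (1 - `|s|) (x M).
rewrite (ger0_norm t0) ![_ + x _]addrC.
move: (normr_ge0 (x N)) (normr_ge0 (x M)); lra.
Qed.

(** * Pointwise operations on C([0,1], E) and small values of functionals *)

Section PointwiseConstructions.
Context {R : realType}.
Implicit Types E F : normedModType R.

Lemma cont01_norm_eval E (f : cont01 E) t : `|f t| <= `|f|.
Proof. exact: cont01_norm_ub. Qed.

Lemma cont01_near_norm E (f : cont01 E) (r : R) :
  r < `|f| -> exists t, r < `|f t|.
Proof.
move=> rf; have := sup_adherent _ (cont01_has_sup f).
move=> /(_ (`|f| - r)); rewrite subr_gt0 => /(_ rf)[_ [t _ <-]].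
rewrite -/(cont01_norm f) -[cont01_norm f]/(`|f|) opprB addrC subrK.
by exists t.
Qed.

Lemma cont01_cst_subproof E (v : E) :
  (fun _ : unit_itv R => v) \in cont01_pred.
Proof. by rewrite inE => t; exact: cst_continuous. Qed.

Definition cont01_cst E (v : E) : cont01 E := Cont01 (cont01_cst_subproof v).

Lemma cont01_cst_norm E (v : E) : `|cont01_cst v| = `|v|.
Proof.
apply/le_anti/andP; split; first by apply: cont01_norm_le => t.
have x0 : (0 : R) \in `[0 : R, 1]%classic.
  by rewrite inE /= in_itv /= lexx ler01.
exact: (cont01_norm_eval (cont01_cst v) (exist _ 0 x0)).
Qed.

Lemma cont01_mul_subproof E (p : cont01 R^o) (f : cont01 E) :
  (fun t => (p t : R) *: f t) \in cont01_pred.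
Proof.
rewrite inE => t; apply: (@cvgZ _ _ _ _ (nbhs_filter t)).
  exact: cont01_continuous.
exact: cont01_continuous.
Qed.

Definition cont01_mul E (p : cont01 R^o) (f : cont01 E) : cont01 E :=
  Cont01 (cont01_mul_subproof p f).

Lemma cont01_sumE E (I : Type) (r : seq I) (f : I -> cont01 E) t :
  (\sum_(i <- r) f i) t = \sum_(i <- r) f i t.
Proof. by elim/big_rec2: _ => // i _ g _ <-. Qed.

Section Map.
Variables (E F : normedModType R) (T : {linear E -> F}).
Hypothesis cT : continuous T.

Lemma cont01_map_subproof (f : cont01 E) : (fun t => T (f t)) \in cont01_pred.
Proof.
rewrite inE => t; apply: continuous_comp; first exact: cont01_continuous.
exact: cT.
Qed.

Definition cont01_map (f : cont01 E) : cont01 F :=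
  Cont01 (cont01_map_subproof f).

Lemma cont01_map_linear : linear cont01_map.
Proof. by move=> a f g; apply/val_inj/funext => t; exact: linearP. Qed.

HB.instance Definition _ := GRing.isLinear.Build R (cont01 E) (cont01 F) *:%R
  cont01_map cont01_map_linear.

Lemma cont01_map_continuous : continuous cont01_map.
Proof.
apply/linear_bounded_continuous/linear_boundedP.
have /linear_bounded_continuous/linear_boundedP := cT.
move=> Tb; near=> r => f; apply: cont01_norm_le => t.
have r0 : 0 <= r by [].
have Tr : forall x, `|T x| <= r * `|x| by near: r.
by apply: le_trans (Tr _) _; rewrite ler_wpM2l// cont01_norm_eval.
Unshelve. all: by end_near. Qed.

End Map.

(* With signs chosen to make all terms nonnegative, the sum of the
   [xs (p j * f)] is at most [|xs| * |f|], whatever [n]. *)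
Lemma exists_small_functional_mul E (xs : {linear cont01 E -> R^o})
    (f : cont01 E) (e : R) : continuous xs -> 0 < e ->
  exists n, forall p : nat -> cont01 R^o,
    (forall j t, 0 <= p j t :> R) ->
    (forall t, \sum_(0 <= j < n) (p j t : R) <= 1) ->
  exists2 j, (j < n)%N & `|xs (cont01_mul (p j) f) : R| < e.
Proof.
move=> /linear_bounded_continuous/linear_boundedP xsb e0.
have [r [r0 xsr]] : exists r : R, 0 <= r /\
    forall g, `|xs g : R| <= r * `|g|.
  case: xsb => M [_ Mb]; exists (`|M| + 1); split; first exact: addr_ge0.
  by apply: Mb; rewrite ltr_pwDr// ler_norm.
(* With this [n], having all [n] values of size at least [e] would break the bound on the signed sum
   [g]. *)
have [n rn] : exists n : nat, r * `|f| < n%:R * e.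
  have := archi_boundP (divr_ge0 (mulr_ge0 r0 (normr_ge0 f)) (ltW e0)).
  by rewrite ltr_pdivrMr//; eexists; eassumption.
exists n => p p0 p1; apply/not_exists2P => small.
have {}small j : (j < n)%N -> e <= `|xs (cont01_mul (p j) f) : R|.
  by move=> jn; have [//|/negP] := small j; rewrite -leNgt.
pose g := \sum_(0 <= j < n)
  Num.sg (xs (cont01_mul (p j) f) : R) *: cont01_mul (p j) f.
suff : n%:R * e <= r * `|f| by rewrite leNgt rn.
apply: (@le_trans _ _ (xs g)).
  rewrite linear_sum /= -[n in n%:R]subn0 mulr_natl -sumr_const_nat.
  apply: ler_sum_nat => j /andP[_ jn].
  by rewrite linearZ /= -[_ *: _]/(_ * _) -normrEsg; exact: small.
apply: le_trans (ler_norm _) _; apply: le_trans (xsr g) _.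
rewrite ler_wpM2l//; apply: cont01_norm_le => t; rewrite cont01_sumE.
apply: le_trans (ler_norm_sum _ _ _) _.
apply: (@le_trans _ _ (\sum_(0 <= j < n) (p j t : R) * `|f|)).
  apply: ler_sum => j _; rewrite /= !normrZ (ger0_norm (p0 j t)).
  rewrite -[leRHS]mul1r ler_pM ?mulr_ge0//.
    by rewrite normr_sg lern1 leq_b1.
  by rewrite ler_wpM2l// cont01_norm_eval.
by rewrite -mulr_suml ler_piMl.
Qed.

End PointwiseConstructions.

(** * Bump functions along a subdivided interval *)

Section Bumps.
Context {R : realType}.

Definition ramp (s : R) : R := Num.min 1 (Num.max 0 s).

Lemma ramp_ge0 s : 0 <= ramp s.
Proof. by rewrite /ramp le_min ler01 le_max lexx. Qed.

Lemma ramp_le1 s : ramp s <= 1.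
Proof. by rewrite /ramp ge_min lexx. Qed.

Lemma ramp_eq0 s : s <= 0 -> ramp s = 0.
Proof. by move=> s0; rewrite /ramp (max_idPl s0) (min_idPr ler01). Qed.

Lemma ramp_eq1 s : 1 <= s -> ramp s = 1.
Proof.
by move=> s1; rewrite /ramp (max_idPr (le_trans ler01 s1)) (min_idPl s1).
Qed.

Lemma le_ramp s t : s <= t -> ramp s <= ramp t.
Proof.
move=> st; have [s0|s0] := leP s 0; first by rewrite ramp_eq0 ?ramp_ge0.
have [t1|t1] := leP 1 t; first by rewrite (ramp_eq1 t1) ramp_le1.
rewrite /ramp (max_idPr (ltW s0)) (max_idPr (ltW (lt_le_trans s0 st))).
by rewrite (min_idPr (ltW t1)) ge_min st orbT.
Qed.

Lemma ramp_continuous : continuous ramp.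
Proof.
by move=> s; apply: continuous_min; [exact: cst_continuous|
  apply: continuous_max => //; exact: cst_continuous].
Qed.

(* As differences of consecutive ramps, the bumps sum up telescopically. *)
Definition bump (a d : R) (j : nat) (t : R) : R :=
  ramp ((t - a) / d - j%:R) - ramp ((t - a) / d - j.+1%:R).

Lemma bump_ge0 a d j t : 0 <= bump a d j t.
Proof. by rewrite subr_ge0 le_ramp// lerB// ler_nat. Qed.

Lemma bump_le1 a d j t : bump a d j t <= 1.
Proof. by rewrite lerBlDr -[leLHS]addr0 lerD ?ramp_le1 ?ramp_ge0. Qed.

Lemma bump_sum_le1 a d n t : \sum_(0 <= j < n) bump a d j t <= 1.
Proof.
rewrite (telescope_sumr_eq (fun j => - ramp ((t - a) / d - j%:R)))//; last first.
  by move=> j _; rewrite /bump opprK addrC.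
by rewrite opprK addrC lerBlDr -[leLHS]addr0 lerD ?ramp_le1 ?ramp_ge0.
Qed.

(** In the variable [(t - a) / d] the bump is a hat rising on [j, j+1] and falling on [j+1, j+2], so
    its peak is at node [j.+1]. *)
Lemma bump_node a d j : d != 0 -> bump a d j (a + j.+1%:R * d) = 1.
Proof.
move=> d0; rewrite /bump [a + _]addrC addrK mulfK// subrr (ramp_eq0 (lexx 0)).
by rewrite subr0 -natrB// subSnn ramp_eq1.
Qed.

(** To the left both ramps are 0, to the right both are 1. The crude left end [a] is enough to keep
    the support inside the subdivided interval. *)
Lemma bump_support a d j t : 0 < d -> bump a d j t != 0 ->
  a <= t <= a + j.+2%:R * d.
Proof.
move=> d0; apply: contraNT; rewrite negb_and -!ltNge => /orP[ta|ta].
  have sneg : (t - a) / d < 0 by rewrite pmulr_llt0 ?invr_gt0// subr_lt0.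
  rewrite /bump !ramp_eq0 ?subrr// subr_le0 (le_trans (ltW sneg))//.
have sbig : j.+2%:R < (t - a) / d by rewrite ltr_pdivlMr// ltrBrDl.
by rewrite /bump !ramp_eq1 ?subrr// lerBrDr nat1r
  (le_trans _ (ltW sbig))// ler_nat.
Qed.

Lemma bump_continuous a d j : continuous (bump a d j).
Proof.
move=> t; have cr i : {for t, continuous (fun t => ramp ((t - a) / d - i%:R))}.
  apply: continuous_comp; last exact: ramp_continuous.
  apply: cvgB; last exact: cvg_cst.
  apply: cvgM; last exact: cvg_cst.
  by apply: cvgB; [exact: cvg_id|exact: cvg_cst].
by apply: cvgB; exact: cr.
Qed.

Lemma cont01_bump_subproof a d j :
  (fun t : unit_itv R => bump a d j (set_val t) : R^o) \in cont01_pred.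
Proof.
rewrite inE => t; apply: continuous_comp; first exact: initial_continuous.
exact: bump_continuous.
Qed.

Definition cont01_bump a d j : cont01 R^o := Cont01 (cont01_bump_subproof a d j).

End Bumps.

(** * Narrowness of operators acting pointwise *)

Lemma near_unit_itv (R : realType) (P : set (unit_itv R)) (t0 : unit_itv R) :
  nbhs t0 P ->
  exists a b : R, [/\ 0 <= a, a < b, b <= 1 &
    forall t : unit_itv R, a <= set_val t <= b -> P t].
Proof.
rewrite nbhs_ballP => -[d /= d0 dP].
have : set_val t0 \in `[0 : R, 1] by have := set_valP t0.
rewrite in_itv /= => /andP[t00 t01].
have d20 : 0 < d / 2 by rewrite divr_gt0.
(* Half the radius keeps the closed interval inside the open ball; after clipping it still has
   positive length, even when [t0] is an endpoint of [0,1]. *)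
exists (Num.max 0 (set_val t0 - d / 2)), (Num.min 1 (set_val t0 + d / 2)).
split; rewrite ?le_max ?ge_min ?lexx//.
  by rewrite gt_max !lt_min ltr01 /=; apply/and3P; split; lra.
move=> t; rewrite ge_max le_min => /andP[/andP[_ h1] /andP[_ h2]].
apply: dP; rewrite -[ball _ _ _]/(ball (set_val t0) d (set_val t)).
by rewrite -ball_normE /= ltr_distlC; apply/andP; split; lra.
Qed.

(** Near a point [t0] where [x] almost attains its norm, [y] is deformed into a vector [v] adapted
    to [x t0] and [y t0]. The interval is so short that [x] and the image of [y] barely vary on it,
    and one of many bumps there makes [xs] small. *)
Lemma cont01_map_narrow (R : realType) (E F : normedModType R)
    (T : {linear E -> F}) (cT : continuous T) :
  exact_strong_daugavet T -> narrow (cont01_map cT).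
Proof.
move=> TD x y x1 y1 xs cxs e e0.
have e4 : 0 < e / 4 by rewrite divr_gt0.
have [t0 xt0] : exists t, 1 - e / 4 < `|x t|.
  by apply: cont01_near_norm; rewrite x1 gtrBl.
have yle t : `|y t| <= 1 by rewrite -y1 cont01_norm_eval.
have [v [v1 Tv xv]] := TD (x t0) (y t0) (yle t0) _ e4.
have /near_unit_itv[a [b [a0 ab b1 Pab]]] : nbhs t0
    ([set t | `|x t0 - x t| <= e / 4] `&`
     [set t | `|T (y t0) - T (y t)| <= e / 4]).
  apply: (@filterI _ _ (nbhs_filter t0)).
    by have /(cvgrPdist_le (FF := nbhs_filter t0))/(_ _ e4) :=
      @cont01_continuous _ _ x t0.
  by have /(cvgrPdist_le (FF := nbhs_filter t0))/(_ _ e4) :=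
    @cont01_continuous _ _ (cont01_map cT y) t0.
have e2 : 0 < e / 2 by rewrite divr_gt0.
have [n xsn] := exists_small_functional_mul (y - cont01_cst v) cxs e2.
(* The last of the [n] bumps ends at node [n.+1], so [n.+1] subintervals hold them all within
   [a, b]. *)
pose d := (b - a) / n.+1%:R.
have d0 : 0 < d by rewrite divr_gt0// subr_gt0.
have ndE : n.+1%:R * d = b - a by rewrite /d mulrC divfK ?pnatr_eq0.
have [j jn xsj] : exists2 j, (j < n)%N &
    `|xs (cont01_mul (cont01_bump a d j) (y - cont01_cst v)) : R| < e / 2.
  by apply: xsn => [j t|t]; [exact: bump_ge0|exact: bump_sum_le1].
have nodeP i : (i <= n.+1)%N -> a <= a + i%:R * d <= b.
  move=> ni; rewrite lerDl mulr_ge0 ?(ltW d0)//=.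
  by rewrite -lerBrDl -ndE ler_pM2r// ler_nat.
set p := cont01_bump a d j; set h := cont01_mul p (y - cont01_cst v).
have hE t : h t = (p t : R) *: (y t - v) by [].
have p0 t : 0 <= p t :> R by exact: bump_ge0.
have p1 t : p t <= 1 :> R by exact: bump_le1.
(* This [u] is the convex combination of [y] and [v] with weight [p]: it equals [y] off the bump and
   [v] at its peak. *)
exists (y - h); split.
- apply: cont01_norm_le => t.
  rewrite -[(y - h) t]/(y t - h t) hE.
  have -> : y t - (p t : R) *: (y t - v) =
      (1 - (p t : R)) *: y t + (p t : R) *: v.
    by rewrite scalerBr [(1 - _) *: _]scalerBl scale1r opprB addrA addrAC.
  apply: le_trans (ler_normD _ _) _; rewrite !normrZ.
  rewrite (ger0_norm (p0 t)) (@ger0_norm _ (1 - _)) ?subr_ge0//.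
  rewrite -[leRHS](subrK (p t : R)).
  by rewrite lerD// ler_piMr// subr_ge0.
(* The norm is tested at the peak, where [u] is [v]. Three losses of [e / 4] occur: in the norm of
   [x t0], in the choice of [v], and in passing from [x t0] to the value of [x] at the peak. *)
- have node01 : a + j.+1%:R * d \in `[0 : R, 1]%classic.
    rewrite inE /= in_itv /=; have /andP[h1 h2] := nodeP j.+1 (ltnW jn).
    by rewrite (le_trans a0 h1) (le_trans h2 b1).
  pose t1 : unit_itv R :=
    exist (fun z : R => z \in `[0 : R, 1]%classic) _ node01.
  have [xt1 _] := Pab t1 (nodeP j.+1 (ltnW jn)).
  apply: lt_le_trans (cont01_norm_eval (x + (y - h)) t1).
  rewrite -[(x + (y - h)) t1]/(x t1 + (y t1 - h t1)) hE.
  have -> : p t1 = 1 :> R by apply: bump_node; rewrite gt_eqF.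
  rewrite scale1r opprB [y t1 + _]addrC subrK.
  have : `|x t0 + v| <= `|x t1 + v| + `|x t0 - x t1|.
    apply: le_trans (ler_normD _ _).
    by rewrite [leRHS](_ : _ = `|x t0 + v|)// addrC addrA subrK.
  move: xt1 => /= xt1; lra.
- rewrite opprB [y + _]addrC subrK.
  suff : `|cont01_map cT h| <= e / 4 by move: xsj; rewrite -/h; lra.
  apply: cont01_norm_le => t; rewrite -[cont01_map cT h t]/(T (h t)) hE.
  rewrite linearZ_LR linearB Tv normrZ.
  (* Where [p] is nonzero, [t] lies in [a, b], and there [T (y t)] is within [e / 4] of [T (y t0)],
     which is exactly [T v]. *)
  rewrite (ger0_norm (p0 t)); have [->|pt] := eqVneq (p t : R) 0.
    by rewrite mul0r ltW.
  have /andP[ta tb] := bump_support d0 pt.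
  have /andP[_ jb] := nodeP j.+2 jn.
  have [_ yt] : _ /\ _ := Pab t (introT andP (conj ta (le_trans tb jb))).
  by rewrite distrC; apply: le_trans yt; rewrite ler_piMl.
Qed.

(** * The two index sets and the tilde-sum that is not narrow *)

Definition evens (k : nat) := ~~ odd k.
(** The extra index 0 is the only overlap with [evens], and both sets keep infinite complements. *)
Definition odds0 (k : nat) := odd k || (k == 0%N).

Lemma tilde_sum_not_narrow (R : realType) :
  ~ narrow (tilde_sum (cont01_map (@sum_on_continuous R evens))
                      (cont01_map (@sum_on_continuous R odds0))).
Proof.
pose x := cont01_cst (ell1_unit 0 : ell1 R).
have x1 : `|x| = 1 by rewrite cont01_cst_norm ell1_norm_unit.
move=> /(_ x (- x) x1); rewrite normrN => /(_ x1).
(* Against the zero functional, only the tilde-sum constrains [u]. *)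
move=> /(_ (\0 : {linear _ -> _}) (@cst_continuous _ _ 0) (1 / 4)).
rewrite divr_gt0// => /(_ isT)[u [u1 xu]].
rewrite [X in _ + X]normr0 addr0 sum1_normE /= => Tu.
have [t xut] := cont01_near_norm xu.
set w := u t; have w1 : `|w| <= 1 by apply: le_trans (cont01_norm_eval u t) u1.
have sumE (A : pred nat) : A 0%N ->
    `|1 + sum_on A w| <= `|cont01_map (@sum_on_continuous R A) (- x - u)|.
  move=> A0; apply: le_trans (cont01_norm_eval _ t).
  rewrite -[cont01_map _ _ t]/(sum_on A (- ell1_unit 0 - w)).
  by rewrite linearB linearN /= sum_on_unit A0 -opprD normrN.
have rw := sumE evens isT; have cw := sumE odds0 isT.
have rcw : sum_on evens w + sum_on odds0 w =
    sum_on (predU evens odds0) w + w 0%N.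
  rewrite sum_on_predUI -(sum_on_pred1 w 0); congr (_ + sum_on _ w).
  apply/funext => k /=; rewrite /evens /odds0.
  by case: (k =P 0%N) => [->//|_]; case: (odd k).
have Uw : `|sum_on (predU evens odds0) w| <= 1.
  exact: le_trans (sum_on_norm_le _ w) w1.
have w01 : `|w 0%N| <= 1.
  by rewrite -(sum_on_pred1 w 0); exact: le_trans (sum_on_norm_le _ w) w1.
(* The two sums add up to less than -7/4 and the sum over the union is at least -1, so [w 0] is
   below -3/4. Then [ell1_unit 0 + w] has norm at most [2 + 2 * w 0], below 1/2, against the lower
   bound 7/4. *)
move: xut; rewrite -[(x + u) t]/(ell1_unit 0 + w) [_ + w]addrC.
rewrite -[ell1_unit 0]scale1r ell1_normD_unit.
have := ler_norm (1 + sum_on evens w : R).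
have := ler_norm (1 + sum_on odds0 w : R).
have := ler_norm (- (sum_on (predU evens odds0) w : R)).
have := ler_norm (- w 0%N); rewrite !normrN.
have w0ge : 0 <= w 0%N + 1 by move: w01; rewrite ler_norml => /andP[]; lra.
rewrite (ger0_norm w0ge); move: rw cw rcw Uw Tu w01 w1.
lra.
Qed.

Theorem theorem3p9 (R : realType) :
  (exists X : completeNormedModType R, narrow_not_tilde_closed X) /\
  narrow_not_tilde_closed (cont01 (ell1 R)).
Proof.
suff H : narrow_not_tilde_closed (cont01 (ell1 R)).
  by split=> //; exists (cont01 (ell1 R)).
exists (cont01 R^o), (cont01 R^o).
exists (cont01_map (@sum_on_continuous R evens)).
exists (cont01_map (@sum_on_continuous R odds0)).
have even2 n : odd n.*2 = false by rewrite odd_double.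
split; try exact: cont01_map_continuous.
- apply: cont01_map_narrow; apply: sum_on_exact_strong_daugavet => n.
    by exists n.*2; rewrite /evens ?even2// -addnn leq_addr.
  by exists n.*2.+1; rewrite /evens /= ?even2// ltnW// ltnS -addnn leq_addr.
- apply: cont01_map_narrow; apply: sum_on_exact_strong_daugavet => n.
    by exists n.*2.+1; rewrite /odds0 /= ?even2// ltnW// ltnS -addnn leq_addr.
  (* The successor avoids the even number 0, which belongs to [odds0]. *)
  by exists n.+1.*2; rewrite /odds0 ?even2// -addnn -addSnnS leq_addl.
- exact: tilde_sum_not_narrow.
Qed.
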